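(* For any $GL_2(K)$-invariant two-sided ideal $I$ of $K\langle x,y\rangle$, the algebra of constants $(K\langle x,y\rangle/I)^{\delta}$ is spanned (as a $K$-vector space) by the highest weight vectors of the $GL_2(K)$-irreducible components of $K\langle x,y\rangle/I$.
   Context: $K$ is a field of characteristic $0$ and $K\langle x,y\rangle$ is the free unitary associative $K$-algebra on $x,y$, bigraded by degrees in $x$ and $y$. $GL_2(K)$ acts naturally on $Kx\oplus Ky$ and diagonally on $K\langle x,y\rangle$ by algebra automorphisms, hence on $K\langle x,y\rangle/I$ for $GL_2(K)$-invariant $I$. $\delta$ is the derivation with $\delta(x)=0$, $\delta(y)=x$ (and the one it induces on $K\langle x,y\rangle/I$), and $(K\langle x,y\rangle/I)^\delta$ is its kernel. For a partition $(\lambda_1,\lambda_2)$, $\lambda_1\ge\lambda_2\ge0$, $W(\lambda_1,\lambda_2)$ denotes the corresponding irreducible polynomial $GL_2(K)$-module. Each irreducible submodule of $K\langle x,y\rangle/I$ isomorphic to $W(\lambda_1,\lambda_2)$ has a unique, up to a multiplicative constant, nonzero element which is bihomogeneous of degree $(\lambda_1,\lambda_2)$ (degree $\lambda_1$ in $x$ and $\lambda_2$ in $y$), called its highest weight vector. The highest weight vectors in the claim are those of all irreducible submodules. *)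

(* Defs.v *)
From HB Require Import structures.
From mathcomp Require Import all_boot all_algebra.
From mathcomp Require Import generic_quotient ring_quotient.
From mathcomp Require boolp.
From mathcomp Require Import finmap mpoly monalg.

Set Implicit Arguments.
Unset Strict Implicit.
Unset Printing Implicit Defensive.

Import GRing.Theory.
Local Open Scope ring_scope.
Local Open Scope quotient_scope.

(* K<x,y> is the monoid algebra of the free monoid of words on the two        *)
(* letters 0 (for x) and 1 (for y).                                           *)
Definition free_alg (K : fieldType) : Type := {malg K[{fmonom 'I_2}]}.

HB.instance Definition _ (K : fieldType) := Choice.on (free_alg K).

(* The operations are those of {malg K[{fmonom 'I_2}]}, locked because their  *)
(* unfolding makes unification very slow.                                     *)
HB.lock Definition free_zero (K : fieldType) : free_alg K :=
  (0 : {malg K[{fmonom 'I_2}]}).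
HB.lock Definition free_opp (K : fieldType) (f : free_alg K) : free_alg K :=
  - (f : {malg K[{fmonom 'I_2}]}).
HB.lock Definition free_add (K : fieldType) (f g : free_alg K) : free_alg K :=
  (f : {malg K[{fmonom 'I_2}]}) + (g : {malg K[{fmonom 'I_2}]}).
HB.lock Definition free_one (K : fieldType) : free_alg K :=
  (1 : {malg K[{fmonom 'I_2}]}).
HB.lock Definition free_mul (K : fieldType) (f g : free_alg K) : free_alg K :=
  (f : {malg K[{fmonom 'I_2}]}) * (g : {malg K[{fmonom 'I_2}]}).
HB.lock Definition free_scale (K : fieldType) (c : K) (f : free_alg K) :
    free_alg K := c *: (f : {malg K[{fmonom 'I_2}]}).

Section FreeAlgebra.
Variable K : fieldType.
Local Notation A := (free_alg K).
Local Notation word := {fmonom 'I_2}.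
Local Notation M := {malg K[word]}.

Fact free_addA : associative (@free_add K).
Proof. by rewrite free_add.unlock; exact: (@addrA M). Qed.
Fact free_addC : commutative (@free_add K).
Proof. by rewrite free_add.unlock; exact: (@addrC M). Qed.
Fact free_add0 : left_id (free_zero K) (@free_add K).
Proof. by rewrite free_add.unlock free_zero.unlock; exact: (@add0r M). Qed.
Fact free_addN : left_inverse (free_zero K) (@free_opp K) (@free_add K).
Proof.
by rewrite free_add.unlock free_zero.unlock free_opp.unlock; exact: (@addNr M).
Qed.
HB.instance Definition _ := GRing.isZmodule.Build A
  free_addA free_addC free_add0 free_addN.

Lemma free_addE (f g : A) : f + g = (f : M) + (g : M).
Proof. by rewrite -[LHS]/(free_add f g) free_add.unlock. Qed.

Fact free_mulA : associative (@free_mul K).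
Proof. by rewrite free_mul.unlock; exact: (@mulrA M). Qed.
Fact free_mul1 : left_id (free_one K) (@free_mul K).
Proof. by rewrite free_mul.unlock free_one.unlock; exact: (@mul1r M). Qed.
Fact free_mulr1 : right_id (free_one K) (@free_mul K).
Proof. by rewrite free_mul.unlock free_one.unlock; exact: (@mulr1 M). Qed.
Fact free_mulDl : left_distributive (@free_mul K) +%R.
Proof.
by move=> f g h; rewrite !free_addE free_mul.unlock; exact: (@mulrDl M).
Qed.
Fact free_mulDr : right_distributive (@free_mul K) +%R.
Proof.
by move=> f g h; rewrite !free_addE free_mul.unlock; exact: (@mulrDr M).
Qed.
Fact free_one_neq0 : free_one K != 0.
Proof.
rewrite -[0]/(free_zero K) free_one.unlock free_zero.unlock.
exact: (@oner_neq0 M).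
Qed.
HB.instance Definition _ := GRing.Zmodule_isNzRing.Build A
  free_mulA free_mul1 free_mulr1 free_mulDl free_mulDr free_one_neq0.

Lemma free_mulE (f g : A) : f * g = (f : M) * (g : M).
Proof. by rewrite -[LHS]/(free_mul f g) free_mul.unlock. Qed.

Lemma free_oneE : (1 : A) = (1 : M).
Proof. by rewrite -[LHS]/(free_one K) free_one.unlock. Qed.

Fact free_scaleA a b (f : A) :
  free_scale a (free_scale b f) = free_scale (a * b) f.
Proof. by rewrite free_scale.unlock; exact: (@scalerA K M). Qed.
Fact free_scale1 : left_id 1 (@free_scale K).
Proof. by rewrite free_scale.unlock; exact: (@scale1r K M). Qed.
Fact free_scaleDr : right_distributive (@free_scale K) +%R.
Proof.
by move=> a f g; rewrite !free_addE free_scale.unlock; exact: (@scalerDr K M).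
Qed.
Fact free_scaleDl (f : A) : {morph (@free_scale K)^~ f : a b / a + b}.
Proof.
by move=> a b; rewrite /= free_addE free_scale.unlock; exact: (@scalerDl K M).
Qed.
HB.instance Definition _ := GRing.Zmodule_isLmodule.Build K A
  free_scaleA free_scale1 free_scaleDr free_scaleDl.

Lemma free_scaleE (c : K) (f : A) : c *: f = c *: (f : M).
Proof. by rewrite -[LHS]/(free_scale c f) free_scale.unlock. Qed.

Fact free_scaleAl (c : K) (f g : A) : c *: (f * g) = c *: f * g.
Proof. by rewrite !free_mulE !free_scaleE; exact: (@scalerAl K M). Qed.
HB.instance Definition _ := GRing.Lmodule_isLalgebra.Build K A free_scaleAl.

Fact free_scaleAr (c : K) (f g : A) : c *: (f * g) = f * (c *: g).
Proof.
have cA (h : M) : c *: h = (malgC c : M) * h by exact: esym (mul_malgC c h).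
have hc (h : M) : h * (malgC c : M) = c *: h.
  rewrite [LHS](fgmulgU c mone h) [RHS]malgZ_def /fgscale.
  by apply: eq_bigr => w _; rewrite mulm1 mulrC.
rewrite !free_mulE !free_scaleE.
have := esym (@mulrA M f (malgC c) g); rewrite hc -cA => <-.
exact: (@scalerAl K M).
Qed.
HB.instance Definition _ := GRing.Lalgebra_isAlgebra.Build K A free_scaleAr.

Definition wcoef (w : word) (f : A) : K := mcoeff w f.
Definition supp (f : A) : seq word := msupp f.
Definition word_mon (w : word) : A := << w >>.
Definition letter (i : 'I_2) : A := word_mon (fmu i).
Definition x : A := letter 0.
Definition y : A := letter 1.

End FreeAlgebra.
Arguments word_mon {K} w.
Arguments letter {K} i.
Arguments x {K}.
Arguments y {K}.

HB.lock Definition lin_ext (K : fieldType)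
    (h : {fmonom 'I_2} -> free_alg K) (f : free_alg K) : free_alg K :=
  \sum_(w <- supp f) wcoef w f *: h w.
Canonical lin_ext_unlockable := Unlockable lin_ext.unlock.

Section FreeAlgebraMaps.
Variable K : fieldType.
Local Notation A := (free_alg K).
Local Notation word := {fmonom 'I_2}.

Lemma wcoefD w (f g : A) : wcoef w (f + g) = wcoef w f + wcoef w g.
Proof. by rewrite free_addE; exact: mcoeffD. Qed.

Lemma wcoefZ w c (f : A) : wcoef w (c *: f) = c * wcoef w f.
Proof. by rewrite free_scaleE; exact: mcoeffZ. Qed.

Lemma wcoef0 w : wcoef w (0 : A) = 0.
Proof. by rewrite -(scale0r (0 : A)) wcoefZ mul0r. Qed.

Lemma wcoef_word_mon v w : wcoef w (word_mon v) = (v == w)%:R :> K.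
Proof. exact: mcoeffU. Qed.

Lemma free_algP (f g : A) : (forall w, wcoef w f = wcoef w g) <-> f = g.
Proof. by split=> [fg|-> //]; apply/malgP. Qed.

Lemma lin_extEw (d : {fset word}) (h : word -> A) (f : A) :
  {subset supp f <= d} -> lin_ext h f = \sum_(w <- d) wcoef w f *: h w.
Proof.
move=> /fsubsetP sfd; rewrite lin_ext.unlock.
rewrite [LHS](big_fset_incl _ sfd) // => w _ wNf.
by rewrite [wcoef w f](mcoeff_outdom wNf) scale0r.
Qed.

Lemma lin_ext_linear (h : word -> A) : linear (lin_ext h).
Proof.
move=> c f g; pose d := (msupp f `|` msupp g `|` msupp (c *: f + g : A))%fset.
have sd (u : A) : msupp u = msupp f \/ msupp u = msupp g \/
    msupp u = msupp (c *: f + g : A) -> {subset supp u <= d}.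
  by rewrite /supp => uE w; rewrite !in_fsetU; case: uE => [|[|]] -> ->;
    rewrite ?orbT.
rewrite !(@lin_extEw d) ?sd; [|by auto..].
rewrite scaler_sumr -big_split /=; apply: eq_bigr => w _.
by rewrite wcoefD wcoefZ scalerDl scalerA.
Qed.

HB.instance Definition _ (h : word -> A) :=
  GRing.isLinear.Build K A A *:%R (lin_ext h) (lin_ext_linear h).

(* The matrix g sends the j-th letter to the combination of the letters given *)
(* by its j-th column; this makes gl_act a left action (gl_actM).             *)
Definition gl_letter (g : 'M[K]_2) (j : 'I_2) : A := \sum_i g i j *: letter i.

Definition gl_word (g : 'M[K]_2) (w : word) : A :=
  \prod_(j <- (w : seq 'I_2)) gl_letter g j.

Definition gl_act (g : 'M[K]_2) : A -> A := lin_ext (gl_word g).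

Fixpoint delta_seq (s : seq 'I_2) : A :=
  if s is i :: s' then
    (if i == 1 then x else 0) * (\prod_(j <- s') letter j)
      + letter i * delta_seq s'
  else 0.

Definition delta : A -> A := lin_ext (fun w => delta_seq w).

Definition bihomog (a b : nat) (f : A) : Prop :=
  {in supp f, forall w : word,
     count_mem 0 (w : seq 'I_2) = a /\ count_mem 1 (w : seq 'I_2) = b}.

HB.instance Definition _ g := GRing.Linear.on (gl_act g).
HB.instance Definition _ := GRing.Linear.on delta.

Lemma gl_act_linear g : linear (gl_act g).
Proof. exact: lin_ext_linear. Qed.

Lemma delta_linear : linear delta.
Proof. exact: lin_ext_linear. Qed.

Lemma lin_ext_word (h : word -> A) w : lin_ext h (word_mon w) = h w.
Proof.
rewrite (@lin_extEw [fset w]%fset); last exact/fsubsetP/msuppU_le.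
by rewrite big_seq_fset1 wcoef_word_mon eqxx scale1r.
Qed.

Lemma word_ind (P : A -> Prop) :
  (forall c f g, P f -> P g -> P (c *: f + g)) -> (forall w, P (word_mon w)) ->
  forall f, P f.
Proof.
move=> Plin Pw f.
have P0 : P 0.
  have := Plin (-1) _ _ (Pw mone) (Pw mone).
  by rewrite scaleN1r addNr.
have -> : f = \sum_(w <- supp f) wcoef w f *: word_mon w.
  apply/free_algP => v; have wcoef_sum := big_morph _ (wcoefD v) (wcoef0 v).
  rewrite wcoef_sum.
  under eq_bigr do rewrite wcoefZ wcoef_word_mon.
  have [vf|vNf] := boolP (v \in supp f).
    rewrite (bigD1_seq v) ?fset_uniq //= eqxx mulr1 big1 ?addr0 // => w wv.
    by rewrite (negPf wv) mulr0.
  rewrite [LHS](mcoeff_outdom vNf) big_seq big1 // => w wf.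
  by case: eqP wf vNf => [-> ->|]; rewrite ?mulr0.
by elim: (supp f) => [|w s IH]; rewrite ?big_nil ?big_cons //; apply: Plin.
Qed.

Lemma word_mon1 : word_mon mone = 1 :> A.
Proof. by rewrite free_oneE. Qed.

Lemma word_monM (v w : word) :
  word_mon v * word_mon w = word_mon (mmul v w) :> A.
Proof. by rewrite free_mulE [LHS](fgmulUU 1 1 v w) mulr1. Qed.

Lemma word_monE (w : word) :
  word_mon w = \prod_(i <- (w : seq 'I_2)) letter i :> A.
Proof.
case: w => s /=; elim: s => [|i s IH].
  by rewrite big_nil -fmoneE free_oneE.
rewrite big_cons -IH /letter word_monM; congr word_mon.
by apply/eqP; rewrite fmP fmM fmU.
Qed.

Lemma gl_act_letter g j : gl_act g (letter j) = \sum_i g i j *: letter i :> A.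
Proof. by rewrite [LHS]lin_ext_word /gl_word fmU big_seq1. Qed.

Lemma gl_act1 g : gl_act g 1 = 1 :> A.
Proof.
by rewrite -word_mon1 [LHS]lin_ext_word /gl_word fm1 big_nil word_mon1.
Qed.

Lemma gl_act_mul g : {morph gl_act g : f1 f2 / f1 * f2}.
Proof.
move=> f1 f2; elim/word_ind: f1 => [c u v IHu IHv|v].
  by rewrite mulrDl -scalerAl !gl_act_linear mulrDl -scalerAl IHu IHv.
elim/word_ind: f2 => [c u u' IHu IHu'|w].
  by rewrite mulrDr -scalerAr !gl_act_linear mulrDr -scalerAr IHu IHu'.
by rewrite word_monM /gl_act !lin_ext_word /gl_word fmM big_cat.
Qed.

Lemma gl_actM g h f : gl_act (g *m h) f = gl_act g (gl_act h f).
Proof.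
elim/word_ind: f => [c u v IHu IHv|w]; first by rewrite !gl_act_linear IHu IHv.
rewrite word_monE; elim: (w : seq _) => [|j s IH].
  by rewrite big_nil !gl_act1.
rewrite big_cons !gl_act_mul IH; congr (_ * _).
rewrite !gl_act_letter linear_sum.
under [RHS]eq_bigr => k _ do rewrite linearZ /= gl_act_letter scaler_sumr.
rewrite exchange_big /=; apply: eq_bigr => i _; rewrite mxE scaler_suml.
by apply: eq_bigr => k _; rewrite scalerA mulrC.
Qed.

Lemma delta_x : delta x = 0 :> A.
Proof. by rewrite [LHS]lin_ext_word fmU /= !mul0r mulr0 addr0. Qed.

Lemma delta_y : delta y = x :> A.
Proof. by rewrite [LHS]lin_ext_word fmU /= big_nil mulr1 mulr0 addr0. Qed.

Lemma delta_seq_cat s t :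
  delta_seq (s ++ t) = delta_seq s * (\prod_(j <- t) letter j)
                       + (\prod_(j <- s) letter j) * delta_seq t.
Proof.
elim: s => [|i s IH] /=; first by rewrite big_nil mul0r mul1r add0r.
by rewrite IH big_cat big_cons !mulrDr mulrDl !mulrA addrA.
Qed.

Lemma delta_mul f g : delta (f * g) = delta f * g + f * delta g.
Proof.
elim/word_ind: f => [c u v IHu IHv|v].
  rewrite mulrDl -scalerAl !delta_linear IHu IHv !mulrDl -!scalerAl scalerDr.
  by rewrite -!addrA; congr (_ + _); rewrite addrCA.
elim/word_ind: g => [c u u' IHu IHu'|w].
  rewrite mulrDr -scalerAr !delta_linear IHu IHu' !mulrDr.
  rewrite -!scalerAr scalerDr.
  by rewrite -!addrA; congr (_ + _); rewrite addrCA.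
by rewrite word_monM /delta !lin_ext_word fmM delta_seq_cat -!word_monE.
Qed.

Definition two_sided_ideal (I : A -> Prop) : Prop :=
  [/\ I 0, forall u v, I u -> I v -> I (u - v),
      forall a u, I u -> I (a * u) & forall a u, I u -> I (u * a)].

Definition gl_invariant (I : A -> Prop) : Prop :=
  forall g f, g \in unitmx -> I f -> I (gl_act g f).

Record ideal : Type := Ideal {
  ideal_set :> A -> Prop;
  idealP : two_sided_ideal ideal_set
}.

(* MathComp quotients are by boolean predicates.                              *)
Definition ideal_pred (I : ideal) : A -> bool := fun f => boolp.asbool (I f).

Lemma ideal_zmod_closed (I : ideal) : zmod_closed (ideal_pred I).
Proof.
have [I0 IB _ _] := idealP I.
split=> [|u v]; first exact/boolp.asboolP.
by move=> /boolp.asboolP Iu /boolp.asboolP Iv; apply/boolp.asboolP/IB.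
Qed.

HB.instance Definition _ (I : ideal) :=
  GRing.isZmodClosed.Build A (ideal_pred I) (ideal_zmod_closed I).

Definition ideal_zmodClosed (I : ideal) : zmodClosed A :=
  GRing.ZmodClosed.clone A (ideal_pred I) _.

End FreeAlgebraMaps.

Section IdealQuotient.
Variables (K : fieldType) (I : ideal K).
Local Notation A := (free_alg K).

Definition quot_alg : Type := {ideal_quot ideal_zmodClosed I}.
HB.instance Definition _ := GRing.Zmodule.on quot_alg.

Definition pi : A -> quot_alg := \pi_{ideal_quot ideal_zmodClosed I}.

Definition rep (q : quot_alg) : A := repr (q : {ideal_quot ideal_zmodClosed I}).

Lemma repK q : pi (rep q) = q.
Proof. exact: reprK. Qed.

Lemma pi_eq f g : pi f = pi g <-> I (f - g).
Proof.
split=> [/eqP|Ifg]; last apply/eqP; rewrite /pi -Quotient.idealrBE.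
  by move/boolp.asboolP.
exact/boolp.asboolP.
Qed.

Definition quot_scale (c : K) (q : quot_alg) : quot_alg := pi (c *: rep q).

Lemma pi_scale c f : quot_scale c (pi f) = pi (c *: f).
Proof.
apply/pi_eq; rewrite -scalerBr -mulr_algl.
by have [_ _ + _] := idealP I; apply; apply/pi_eq; rewrite repK.
Qed.

Lemma piD : {morph pi : f g / f + g}.
Proof. by move=> f g; rewrite /pi raddfD. Qed.

Lemma quot_scaleA a b q : quot_scale a (quot_scale b q) = quot_scale (a * b) q.
Proof. by rewrite -[q]repK !pi_scale scalerA. Qed.

Lemma quot_scale1 : left_id 1 quot_scale.
Proof. by move=> q; rewrite -[q]repK pi_scale scale1r. Qed.

Lemma quot_scaleDr : right_distributive quot_scale +%R.
Proof.
move=> a p q; rewrite -[p]repK -[q]repK.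
by rewrite -piD !pi_scale scalerDr piD.
Qed.

Lemma quot_scaleDl q : {morph quot_scale^~ q : a b / a + b}.
Proof. by move=> a b; rewrite -[q]repK !pi_scale scalerDl piD. Qed.

HB.instance Definition _ := GRing.Zmodule_isLmodule.Build K quot_alg
  quot_scaleA quot_scale1 quot_scaleDr quot_scaleDl.

(* The induced maps are computed on chosen representatives; this does not     *)
(* depend on the choice when I is GL_2-invariant (for delta, because K is     *)
(* infinite of characteristic 0, so that delta maps I to I).                  *)
Definition quot_gl (g : 'M[K]_2) (q : quot_alg) : quot_alg :=
  pi (gl_act g (rep q)).

Definition quot_delta (q : quot_alg) : quot_alg := pi (delta (rep q)).

Lemma pi_gl g f : gl_invariant I -> g \in unitmx ->
  quot_gl g (pi f) = pi (gl_act g f).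
Proof.
move=> Iinv gU; apply/pi_eq; rewrite -linearB.
by apply: (Iinv) => //; apply/pi_eq; rewrite repK.
Qed.

Definition delta_constant (q : quot_alg) : Prop := quot_delta q = 0.

Definition quot_bihomog (a b : nat) (q : quot_alg) : Prop :=
  exists2 f : A, bihomog a b f & q = pi f.

Definition gl_submodule (M : quot_alg -> Prop) : Prop :=
  [/\ M 0, forall c u v, M u -> M v -> M (c *: u + v)
    & forall g u, g \in unitmx -> M u -> M (quot_gl g u)].

Definition irreducible_submodule (M : quot_alg -> Prop) : Prop :=
  [/\ gl_submodule M, exists2 u, M u & u != 0
    & forall N, gl_submodule N -> (forall u, N u -> M u) ->
        (forall u, N u -> u = 0) \/ (forall u, M u -> N u)].

(* W(l1, l2) is det^l2 (x) Sym^(l1 - l2)(K^2), with Sym^n(K^2) the forms of   *)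
(* degree n in two commuting variables.                                       *)
Definition W_act (l2 : nat) (g : 'M[K]_2) (p : mpoly 2 K) : mpoly 2 K :=
  \det g ^+ l2 *: (p \mPo [tuple \sum_i g i j *: 'X_i | j < 2]).

(* The isomorphism W(l1, l2) -> M is given as the restriction to forms of     *)
(* degree l1 - l2 of a linear map defined on all polynomials.                 *)
Definition iso_W (l1 l2 : nat) (M : quot_alg -> Prop) : Prop :=
  exists phi : {linear mpoly 2 K -> quot_alg},
    [/\ {in (l1 - l2)%N.-homog &, injective phi},
        forall u, M u <-> exists2 p, p \is (l1 - l2)%N.-homog & u = phi p
      & forall g p, g \in unitmx -> p \is (l1 - l2)%N.-homog ->
          phi (W_act l2 g p) = quot_gl g (phi p)].

Definition highest_weight_vector (q : quot_alg) : Prop :=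
  exists (M : quot_alg -> Prop) (l1 l2 : nat),
    [/\ (l2 <= l1)%N, irreducible_submodule M, iso_W l1 l2 M
      & [/\ M q, q != 0 & quot_bihomog l1 l2 q]].

Definition in_span (S : quot_alg -> Prop) (q : quot_alg) : Prop :=
  exists s : seq (K * quot_alg),
    (forall t, t \in s -> S t.2) /\ q = \sum_(t <- s) t.1 *: t.2.

End IdealQuotient.

(* Main.v *)
From HB Require Import structures.
Require Import Defs.
From mathcomp Require Import all_boot all_algebra.
From mathcomp Require Import monalg mpoly ring zify.

Set Implicit Arguments.
Unset Strict Implicit.
Unset Printing Implicit Defensive.

Import GRing.Theory.
Local Open Scope ring_scope.

(** Write Q for the quotient and u_t for the unipotent matrix fixing x and
    sending y to y + t x.

    On the free algebra u_t acts as the exponential of t delta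
    ([gl_act_upper]), and K is infinite.  A polynomial in t with vector
    coefficients that takes its values in a subspace has its coefficients in
    that subspace ([isolate_coef]).  Hence delta preserves every GL_2-invariant
    ideal, and an element of Q is a constant exactly when all the u_t fix it
    ([delta_constantP]): the constants are the invariants of the unipotent
    group.

    The torus normalizes the unipotent group, so it acts on the constants, and
    the same extraction of coefficients, applied to the torus action, splits a
    constant into bihomogeneous constants ([delta_constant_bihomog]).  It
    remains to see that the nonzero bihomogeneous constants are the highest
    weight vectors.

    Let q be a nonzero constant of bidegree (a, b).  A matrix with a nonzero
    upper left entry is lower unipotent times diagonal times upper unipotent;
    the last two factors only scale q, so its orbit is governed by the lower
    unipotent group, which acts through a polynomial sum of t^j e_j.  Letting
    the upper left entry s of a matrix of determinant 1 vary, g q is a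
    polynomial in s and at the same time the Laurent polynomial
    sum of s^(a - b - j) e_j.  So e_j = 0 for j > a - b, which forces b <= a
    because e_0 = q is nonzero, and every g in GL_2 satisfies
      g q = det(g)^b  sum over j <= n of  g_00^(n - j) g_10^j e_j,  n = a - b
    ([hw_orbit]).  This is the formula for the action of g on X^n in W(a, b).
    Therefore the linear map sending X^(n - j) Y^j to e_j / 'C(n, j) is
    equivariant on the powers of linear forms, which span the forms of degree n
    ([eq_on_lin_pow]).  It is injective and its image is irreducible because a
    subspace of forms stable under the u_t and nonzero contains X^n
    ([raising_contains_X]).  So q is a highest weight vector
    ([constant_highest_weight]).

    Conversely, in W(a, b) the torus weight (a, b) occurs only on the multiples
    of X^n, and these are fixed by the u_t ([highest_weight_constant]). *)

(** * Extracting coefficients over an infinite field *)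

Section Polynomial.
Variables (K : fieldType) (charK0 : [pchar K] =i pred0).

Lemma natr_neq0 n : (0 < n)%N -> n%:R != 0 :> K.
Proof. by rewrite (proj1 (pcharf0P K) charK0) -lt0n. Qed.

Lemma exp2_inj : injective (fun n : nat => 2 ^+ n : K).
Proof.
have le_inj m n : (m <= n)%N -> 2 ^+ m = 2 ^+ n :> K -> m = n.
  move=> le_mn /eqP; rewrite eq_sym -subr_eq0 -!natrX -natrB ?leq_exp2l //.
  rewrite (proj1 (pcharf0P K) charK0) subn_eq0 leq_exp2l // => le_nm.
  by apply/eqP; rewrite eqn_leq le_mn.
by move=> m n; case/orP: (leq_total m n) => [/le_inj//|/le_inj inj /esym/inj].
Qed.

Definition subspace (V : lmodType K) (N : V -> Prop) : Prop :=
  N 0 /\ forall c u v, N u -> N v -> N (c *: u + v).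

Lemma subspace0 (V : lmodType K) : subspace (fun v : V => v = 0).
Proof. by split=> // c u v -> ->; rewrite scaler0 addr0. Qed.

Section Subspace.
Variables (V : lmodType K) (N : V -> Prop) (subN : subspace N).

Lemma subspaceZ c v : N v -> N (c *: v).
Proof.
by move=> Nv; rewrite -[_ *: _]addr0; apply: subN.2 => //; apply: subN.1.
Qed.

Lemma subspaceD u v : N u -> N v -> N (u + v).
Proof. by move=> Nu Nv; rewrite -[u]scale1r; apply: subN.2. Qed.

Lemma subspace_sum (J : eqType) (r : seq J) (P : pred J) (F : J -> V) :
  (forall i, i \in r -> P i -> N (F i)) -> N (\sum_(i <- r | P i) F i).
Proof.
move=> NF; rewrite big_seq_cond; apply: big_ind; first exact: subN.1.
  exact: subspaceD.
by move=> i /andP[]; apply: NF.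
Qed.

(** Vandermonde argument: if F(s) is the sum evaluated at s, then
    F(2 s) - 2^l F(s) kills the terms of exponent l and multiplies a term of
    exponent i by the nonzero scalar 2^i - 2^l.  Doing this for every exponent
    other than k leaves a nonzero multiple of the component of exponent k.
    Exponents may repeat, and evaluation at the nonzero scalars 2^m suffices,
    which is what is needed when s is an entry of an invertible matrix. *)
Lemma isolate_exponent (J : eqType) (r : seq J) (e : J -> nat) (v : J -> V) :
    (forall m, N (\sum_(i <- r) (2 ^+ m) ^+ e i *: v i)) ->
  forall k, N (\sum_(i <- r | e i == k) v i).
Proof.
move=> Nr k.
have kill E m : N (\sum_(i <- r)
    (\prod_(l <- E) (2 ^+ e i - 2 ^+ l) * (2 ^+ m) ^+ e i) *: v i).
  elim: E m => [|l E IH] m.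
    by under eq_bigr => i _ do rewrite big_nil mul1r; apply: Nr.
  pose S m := \sum_(i <- r)
    (\prod_(l <- E) (2 ^+ e i - 2 ^+ l) * (2 ^+ m) ^+ e i) *: v i.
  rewrite (_ : \sum_(i <- r) _ = - 2 ^+ l *: S m + S m.+1).
    by apply: subN.2; apply: IH.
  rewrite /S scaler_sumr -big_split /=; apply: eq_bigr => i _.
  rewrite big_cons scalerA -scalerDl exprS exprMn; congr (_ *: _); ring.
pose E := [seq e i | i <- r & e i != k].
(* The scalar by which the surviving component gets multiplied. *)
pose c : K := \prod_(l <- E) (2 ^+ k - 2 ^+ l).
have c_neq0 : c != 0.
  rewrite prodf_seq_neq0; apply/allP => l /mapP[i]; rewrite mem_filter.
  move=> /andP[ik _] ->; rewrite subr_eq0; apply/negP => /eqP/exp2_inj ki.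
  by rewrite ki eqxx in ik.
rewrite (_ : \sum_(i <- r | _) _ = c^-1 *: \sum_(i <- r)
    (\prod_(l <- E) (2 ^+ e i - 2 ^+ l) * (2 ^+ 0) ^+ e i) *: v i).
  exact: subspaceZ.
rewrite scaler_sumr [LHS]big_seq_cond [RHS]big_seq big_mkcondr /=.
apply: eq_bigr => i ri; rewrite expr0 expr1n mulr1 scalerA.
case: eqP => [->|/eqP ik]; first by rewrite mulVf ?scale1r.
suff -> : \prod_(l <- E) (2 ^+ e i - 2 ^+ l) = 0 :> K by rewrite mulr0 scale0r.
apply/eqP; rewrite prodf_seq_eq0; apply/hasP.
exists (e i); last by rewrite /= subrr.
by apply/mapP; exists i; rewrite // mem_filter ik ri.
Qed.

Lemma isolate_coef n (v : nat -> V) :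
    (forall t, N (\sum_(k < n) t ^+ k *: v k)) ->
  forall k, (k < n)%N -> N (v k).
Proof.
move=> Nt k lt_kn.
have := isolate_exponent (e := fun i : 'I_n => i) (fun m => Nt (2 ^+ m)) k.
by rewrite (big_pred1 (Ordinal lt_kn)).
Qed.
End Subspace.
End Polynomial.

(** * Invertible matrices of size 2 *)

Section Matrices.
Variable K : fieldType.

Definition mx2 (a b c d : K) : 'M[K]_2 := \matrix_(i < 2, j < 2)
  if i == 0 then (if j == 0 then a else b) else (if j == 0 then c else d).

Lemma mx2_eta (g : 'M[K]_2) : g = mx2 (g 0 0) (g 0 1) (g 1 0) (g 1 1).
Proof.
apply/matrixP => i j; rewrite mxE.
by case: i j => [[|[|[]]] // ?] [[|[|[]]] // ?]; congr (g _ _); apply: val_inj.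
Qed.

Lemma mx2M a b c d a' b' c' d' : mx2 a b c d *m mx2 a' b' c' d' =
  mx2 (a * a' + b * c') (a * b' + b * d') (c * a' + d * c') (c * b' + d * d').
Proof.
apply/matrixP => i j; rewrite !mxE !big_ord_recl big_ord0 !mxE /= addr0.
by case: i j => [[|[|[]]] // ?] [[|[|[]]] // ?].
Qed.

Lemma det_mx2 a b c d : \det (mx2 a b c d) = a * d - b * c.
Proof.
rewrite (expand_det_row _ 0) !big_ord_recl big_ord0 /cofactor !det_mx11 !mxE /=.
rewrite addr0; ring.
Qed.

Lemma mx2_unit a b c d : (mx2 a b c d \in unitmx) = (a * d - b * c != 0).
Proof. by rewrite unitmxE unitfE det_mx2. Qed.

Definition upper t := mx2 1 t 0 1.
Definition lower t := mx2 1 0 t 1.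
Definition torus s r := mx2 s 0 0 r.
(** The Weyl element, with the sign that gives it determinant 1. *)
Definition weyl := mx2 0 (-1) 1 0.

Lemma upper_unit t : upper t \in unitmx.
Proof. by rewrite mx2_unit mulr1 mulr0 subr0 oner_neq0. Qed.

Lemma lower_unit t : lower t \in unitmx.
Proof. by rewrite mx2_unit mulr1 mul0r subr0 oner_neq0. Qed.

Lemma torus_unit s r : (torus s r \in unitmx) = (s != 0) && (r != 0).
Proof. by rewrite mx2_unit mulr0 subr0 mulf_eq0 negb_or. Qed.

Lemma weyl_unit : weyl \in unitmx.
Proof. by rewrite mx2_unit !mulr1 mulr0 sub0r opprK oner_neq0. Qed.

End Matrices.

(** * The action on the free algebra *)

Section FreeAlgebra.
Variables (K : fieldType) (charK0 : [pchar K] =i pred0).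
Local Notation A := (free_alg K).
Local Notation word := {fmonom 'I_2}.

Lemma sum_word_mon (f : A) : f = \sum_(w <- supp f) wcoef w f *: word_mon w.
Proof.
transitivity (lin_ext (@word_mon K) f); last by rewrite lin_ext.unlock.
elim/word_ind: f => [c f g IHf IHg|w]; last by rewrite lin_ext_word.
by rewrite lin_ext_linear -IHf -IHg.
Qed.

Lemma ord2P (i : 'I_2) : {i = 0} + {i = 1}.
Proof.
by case: i => [[|[|[]]] // ?]; [left | right]; apply: val_inj.
Qed.

Lemma gl_act_x (a b c d : K) : gl_act (mx2 a b c d) x = a *: x + c *: y.
Proof.
rewrite gl_act_letter !big_ord_recl big_ord0 !mxE addr0 /=.
by congr (_ + _ *: letter _); apply: val_inj.
Qed.

Lemma gl_act_y (a b c d : K) : gl_act (mx2 a b c d) y = b *: x + d *: y.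
Proof.
rewrite gl_act_letter !big_ord_recl big_ord0 !mxE addr0 /=.
by congr (_ + _ *: letter _); apply: val_inj.
Qed.

Lemma gl_act_torus_word (s r : K) (w : word) : gl_act (torus s r) (word_mon w) =
  (s ^+ count_mem 0 (w : seq 'I_2) * r ^+ count_mem 1 (w : seq 'I_2))
    *: word_mon w.
Proof.
rewrite word_monE; elim: (w : seq _) => [|i u IH].
  by rewrite !big_nil gl_act1 mulr1 scale1r.
rewrite big_cons gl_act_mul IH.
case: (ord2P i) => -> /=; rewrite -?/x -?/y ?gl_act_x ?gl_act_y scale0r.
  by rewrite addr0 -scalerAl -scalerAr scalerA exprS mulrA.
by rewrite add0r -scalerAl -scalerAr scalerA exprS mulrCA.
Qed.

Lemma gl_act_torus_bihomog (s r : K) a b (f : A) : bihomog a b f ->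
  gl_act (torus s r) f = (s ^+ a * r ^+ b) *: f.
Proof.
move=> fab; rewrite [f in LHS]sum_word_mon [f in RHS]sum_word_mon.
rewrite linear_sum scaler_sumr big_seq [RHS]big_seq; apply: eq_bigr => w fw.
have [a_w b_w] := fab w fw; rewrite linearZ /= gl_act_torus_word a_w b_w.
by rewrite !scalerA mulrC.
Qed.

Lemma iter_delta_linear k : linear (iter k (@delta K)).
Proof. by elim: k => // k IH c f g; rewrite !iterS IH delta_linear. Qed.

Lemma iter_delta_x k f : iter k (@delta K) (x * f) = x * iter k (@delta K) f.
Proof.
by elim: k => // k IH; rewrite !iterS IH delta_mul delta_x mul0r add0r.
Qed.

Lemma iter_delta_y k f : iter k.+1 (@delta K) (y * f) =
  y * iter k.+1 (@delta K) f + k.+1%:R *: (x * iter k (@delta K) f).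
Proof.
elim: k => [|k IH]; first by rewrite /= delta_mul delta_y addrC scale1r.
rewrite iterS IH addrC delta_linear !delta_mul delta_x mul0r add0r delta_y.
by rewrite -!iterS addrA addrC -[k.+2]addn1 natrD scalerDl scale1r.
Qed.

(** Here u_t is exp(t delta).  Since delta is locally nilpotent the series is
    finite; the bound N0 does not depend on t, so that the right-hand side is
    one polynomial in t, and it is only required to be large enough, so that the
    polynomials of several elements can be given a common length.  On a word
    that starts with y, iterating the Leibniz rule produces the two summands of
    u_t y = y + t x. *)
Lemma gl_act_upper (f : A) : exists N0, forall N, (N0 <= N)%N -> forall t,
  gl_act (upper t) f = \sum_(k < N) (t ^+ k / k`!%:R) *: iter k (@delta K) f.
Proof.
elim/word_ind: f => [c f g [Nf IHf] [Ng IHg]|w].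
  exists (maxn Nf Ng) => N; rewrite geq_max => /andP[leNf leNg] t.
  rewrite gl_act_linear (IHf N) // (IHg N) // scaler_sumr -big_split /=.
  apply: eq_bigr => k _.
  by rewrite iter_delta_linear scalerDr !scalerA (mulrC c).
exists (size (w : seq 'I_2)).+1; rewrite word_monE.
elim: (w : seq _) => [|i s IH] [|N] // leN t.
  rewrite big_nil gl_act1 big_ord_recl big1 ?addr0 ?divr1 ?scale1r // => k _.
  rewrite (_ : iter _ _ _ = 0) ?scaler0 //.
  rewrite lift0; elim: (nat_of_ord k) => [|j IHj].
    by rewrite -word_mon1 [LHS]lin_ext_word fm1.
  by rewrite iterS IHj linear0.
rewrite big_cons gl_act_mul; set f := \prod_(j <- s) _.
have [lt_sN lt_sN1] : (size s < N.+1 /\ size s < N)%N by rewrite ltnW.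
case: (ord2P i) => ->; rewrite -?/x -?/y ?gl_act_x ?gl_act_y.
  rewrite scale1r scale0r addr0 (IH N.+1) // mulr_sumr.
  by apply: eq_bigr => k _; rewrite iter_delta_x scalerAr.
rewrite scale1r addrC mulrDl {1}(IH N.+1) // (IH N) // mulr_sumr mulr_sumr.
rewrite big_ord_recl [RHS]big_ord_recl -addrA; congr (_ + _).
  by rewrite -scalerAr.
rewrite -big_split; apply: eq_bigr => k _.
rewrite !lift0 iter_delta_y scalerDr -scalerAr scalerA -scalerAl -scalerAr.
rewrite scalerA.
congr (_ + _ *: _); rewrite factS natrM exprS.
have k0 : k.+1%:R != 0 :> K by apply: natr_neq0.
have f0 : k`!%:R != 0 :> K by apply: natr_neq0; rewrite ?fact_gt0.
by field; rewrite nat1r f0 k0.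
Qed.
End FreeAlgebra.

Section Bihomogeneous.
Variable K : fieldType.
Local Notation A := (free_alg K).

Lemma supp_wcoef w (f : A) : (wcoef w f != 0) = (w \in supp f).
Proof. by apply: negb_inj; rewrite negbK; apply: monalg.mcoeff_eq0. Qed.

Lemma subspace_bihomog a b : subspace (@bihomog K a b).
Proof.
split=> [w|c f g abf abg w]; first by rewrite -supp_wcoef wcoef0 eqxx.
rewrite -supp_wcoef wcoefD wcoefZ => cw.
have [/eqP gw|] := boolP (wcoef w g == 0); last by rewrite supp_wcoef => /abg.
apply: abf; rewrite -supp_wcoef; apply: contraNneq cw => ->.
by rewrite gw mulr0 addr0.
Qed.
End Bihomogeneous.

(** * Constants are the invariants of the unipotent group *)

Section Quotient.
Variables (K : fieldType) (charK0 : [pchar K] =i pred0).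
Variables (I : ideal K) (I_inv : gl_invariant I).
Local Notation A := (free_alg K).
Local Notation word := {fmonom 'I_2}.
Local Notation Q := (quot_alg I).
Local Notation gl := (@quot_gl K I).
Local Notation pi := (@Defs.pi K).

Lemma pi_linear : linear (pi I).
Proof. by move=> c f g; rewrite piD -pi_scale. Qed.
HB.instance Definition _ :=
  GRing.isLinear.Build K A Q *:%R (pi I) pi_linear.

Lemma pi0P f : pi I f = 0 <-> I f.
Proof. by rewrite -(linear0 (pi I)) pi_eq subr0. Qed.

Lemma subspace_ideal : subspace I.
Proof.
split=> [|c u v]; first by apply/pi0P; rewrite linear0.
by move=> /pi0P Iu /pi0P Iv; apply/pi0P; rewrite linearP /= Iu Iv scaler0 addr0.
Qed.

Lemma quot_gl_linear g : g \in unitmx -> linear (gl g).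
Proof.
move=> gU c u v; rewrite -[u]repK -[v]repK -linearP !pi_gl // gl_act_linear.
exact: pi_linear.
Qed.

Lemma quot_gl0 g : g \in unitmx -> gl g 0 = 0.
Proof. by move=> gU; rewrite -{1}(linear0 (pi I)) pi_gl // !linear0. Qed.

Lemma quot_glZ g c v : g \in unitmx -> gl g (c *: v) = c *: gl g v.
Proof.
by move=> gU; rewrite -[c *: v]addr0 quot_gl_linear // quot_gl0 // addr0.
Qed.

Lemma quot_gl_sum g (J : Type) (r : seq J) (P : pred J) (v : J -> Q) :
  g \in unitmx ->
  gl g (\sum_(i <- r | P i) v i) = \sum_(i <- r | P i) gl g (v i).
Proof.
move=> gU; apply: big_morph; last exact: quot_gl0.
by move=> u w; rewrite -{1}[u]scale1r quot_gl_linear // scale1r.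
Qed.

Lemma quot_glM g h v : g \in unitmx -> h \in unitmx ->
  gl (g *m h) v = gl g (gl h v).
Proof.
move=> gU hU; rewrite -[v]repK !pi_gl ?gl_actM //.
by rewrite unitmx_mul gU hU.
Qed.

(** For f in I the polynomial t |-> u_t f takes its values in I, and delta f
    is its coefficient of degree 1. *)
Lemma ideal_delta f : I f -> I (delta f).
Proof.
move=> If; have [N0 fE] := gl_act_upper charK0 f.
have N2 : (1 < maxn N0 2)%N by rewrite leq_max orbT.
have := isolate_coef charK0 subspace_ideal (n := maxn N0 2)
  (v := fun k => k`!%:R^-1 *: iter k (@delta K) f) _ N2.
rewrite /= invr1 scale1r; apply=> t.
have := I_inv (upper_unit t) If; rewrite (fE (maxn N0 2)) ?leq_maxl //.
by congr (I _); apply: eq_bigr => k _; rewrite scalerA.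
Qed.

(** The value of the induced derivation does not depend on the representative
    because delta preserves I. *)
Lemma delta_constant_pi f : delta_constant (pi I f) <-> I (delta f).
Proof.
have Irep : I (delta (rep (pi I f) - f)).
  by apply: ideal_delta; apply/pi_eq; rewrite repK.
rewrite linearB /= in Irep; rewrite /delta_constant /quot_delta pi0P.
by rewrite -!pi0P; move/pi_eq: Irep => ->.
Qed.

(** The coefficients v k are delta^k q / k!. *)
Lemma quot_gl_upper (q : Q) : exists N0 (v : nat -> Q), v 0 = q /\
  forall N, (N0 <= N)%N -> forall t,
    gl (upper t) q = \sum_(k < N) t ^+ k *: v k.
Proof.
have [N0 fE] := gl_act_upper charK0 (rep q).
exists N0, (fun k => pi I (k`!%:R^-1 *: iter k (@delta K) (rep q))); split.
  by rewrite /= invr1 scale1r repK.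
move=> N leN t; rewrite -{1}[q]repK pi_gl ?upper_unit // (fE N) // linear_sum.
by apply: eq_bigr => k _; rewrite -scalerA linearZ.
Qed.

(** If delta q = 0 the exponential series of u_t q reduces to q; conversely
    delta q is the coefficient of t in u_t q - q. *)
Lemma delta_constantP (q : Q) :
  delta_constant q <-> forall t, gl (upper t) q = q.
Proof.
rewrite -[q]repK delta_constant_pi; set f := rep q.
have [N0 fE] := gl_act_upper charK0 f.
have {}fE t : gl (upper t) (pi I f) = pi I f +
    \sum_(k < N0.+1) (t ^+ k.+1 / k.+1`!%:R) *: pi I (iter k.+1 (@delta K) f).
  rewrite pi_gl ?upper_unit // (fE N0.+2) ?leqW // linear_sum big_ord_recl.
  rewrite linearZ /= divr1 scale1r; congr (_ + _).
  by apply: eq_bigr => k _; rewrite linearZ.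
split=> [Idf t | fixf].
  rewrite fE big1 ?addr0 // => k _; rewrite (_ : pi I _ = 0) ?scaler0 //.
  by apply/pi0P; elim: (nat_of_ord k) => // j /ideal_delta.
(* Coefficients of u_t q - q as a polynomial in t. *)
pose v k := if k is k'.+1 then
  (k'.+1)`!%:R^-1 *: pi I (iter k'.+1 (@delta K) f) else 0.
have : v 1 = 0.
  apply: (isolate_coef charK0 (subspace0 _) (n := N0.+2)) => // t.
  have /eqP := fixf t; rewrite fE -subr_eq0 addrAC subrr add0r => /eqP sum0.
  rewrite big_ord_recl scaler0 add0r -[RHS]sum0.
  by apply: eq_bigr => k _; rewrite lift0 /= scalerA.
by rewrite /v /= invr1 scale1r => /pi0P.
Qed.

Lemma subspace_delta_constant : subspace (@delta_constant K I).
Proof.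
split=> [|c u v].
  rewrite -[0](linear0 (pi I)) delta_constant_pi linear0.
  exact: subspace_ideal.1.
rewrite !delta_constantP => fixu fixv t.
by rewrite quot_gl_linear ?upper_unit // fixu fixv.
Qed.

Lemma quot_gl_torus s r a b (q : Q) : s != 0 -> r != 0 -> quot_bihomog a b q ->
  gl (torus s r) q = (s ^+ a * r ^+ b) *: q.
Proof.
move=> s0 r0 [f fab ->]; rewrite pi_gl ?torus_unit ?s0 //.
by rewrite (gl_act_torus_bihomog _ _ fab) linearZ.
Qed.

(** The torus normalizes the unipotent group: u_t d = d u_(t r / s) for
    d = diag(s, r). *)
Lemma torus_delta_constant s r (q : Q) : s != 0 -> r != 0 ->
  delta_constant q -> delta_constant (gl (torus s r) q).
Proof.
move=> s0 r0; rewrite !delta_constantP => fixq t.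
have TU : torus s r \in unitmx by rewrite torus_unit s0.
rewrite -quot_glM ?upper_unit // -{2}(fixq (t * r / s)).
rewrite -quot_glM ?upper_unit //; congr (gl _ q).
by rewrite !mx2M; congr mx2; field.
Qed.

(** The element diag(z, z^B), with B larger than the length of every word of f,
    multiplies a word of bidegree (i, j) by z^(i + B j), an exponent from which
    (i, j) can be read off by division with remainder.  Isolating exponents in
    the subspace of constants shows that each bihomogeneous component is a
    constant. *)
Lemma delta_constant_bihomog (q : Q) : delta_constant q ->
  exists r : seq Q, q = \sum_(u <- r) u /\
    forall u, u \in r -> delta_constant u /\ exists a b, quot_bihomog a b u.
Proof.
rewrite -[q]repK; set f := rep q => constf.
pose c0 (w : word) := count_mem 0 (w : seq 'I_2).
pose c1 (w : word) := count_mem 1 (w : seq 'I_2).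
pose B := (\max_(w <- supp f) size (w : seq 'I_2)).+1.
have c0B w : w \in supp f -> (c0 w < B)%N.
  move=> fw; apply: leq_ltn_trans (count_size _ _) _; rewrite ltnS.
  exact: (leq_bigmax_seq (F := fun w : word => size (w : seq 'I_2))).
pose e w := (c1 w * B + c0 w)%N.
pose F (k : nat) := \sum_(w <- supp f | e w == k) wcoef w f *: (word_mon w : A).
pose M := (\max_(w <- supp f) e w).+1.
exists [seq pi I (F (val k)) | k <- index_enum 'I_M].
split=> [|u /mapP[k _ ->]].
  rewrite {1}[f]sum_word_mon big_map -linear_sum; congr (pi I _).
  rewrite (exchange_big_dep xpredT) //= big_seq [RHS]big_seq.
  apply: eq_bigr => w fw.
  have lt_eM : (e w < M)%N by rewrite ltnS; exact: (leq_bigmax_seq (F := e)).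
  by rewrite (big_pred1 (Ordinal lt_eM)) // => k; rewrite eq_sym.
split; last first.
  exists (k %% B)%N, (k %/ B)%N, (F k) => //.
  have subab := @subspace_bihomog K (k %% B) (k %/ B).
  rewrite /F. apply: (subspace_sum subab) => w fw /eqP <- v.
  rewrite -supp_wcoef wcoefZ wcoef_word_mon.
  case: (eqVneq w v) => [<- _|_]; last by rewrite mulr0 eqxx.
  by rewrite modnMDl modn_small ?c0B // divnMDl // divn_small ?c0B ?addn0.
rewrite linear_sum.
apply: (isolate_exponent charK0 subspace_delta_constant) => m.
have z0 : 2 ^+ m != 0 :> K by rewrite expf_neq0 // natr_neq0.
have z0B : (2 ^+ m) ^+ B != 0 :> K by rewrite expf_neq0.
have := torus_delta_constant z0 z0B constf.
rewrite pi_gl ?torus_unit ?z0 // {1}[f]sum_word_mon !linear_sum.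
congr (delta_constant _); apply: eq_bigr => w _.
rewrite !linearZ /= gl_act_torus_word linearZ /= !scalerA.
set z := 2 ^+ m; have -> : z ^+ e w = z ^+ c0 w * (z ^+ B) ^+ c1 w.
  by rewrite -exprM -exprD addnC mulnC.
by rewrite mulrC.
Qed.

(** * The orbit of a bihomogeneous constant *)

(** The formula holds on the big cell (upper left entry nonzero) by the
    lower-diagonal-upper decomposition, with a sum that is not yet bounded by
    a - b.  The matrices with rows (s, -1) and (1, 0) are u_s w with w the Weyl
    element, so they act on q by a polynomial in s, while the big cell gives
    powers s^(a - b - j).  Comparing the two bounds the sum; the coefficient of
    s^0 gives w q = e_(a - b), which settles the matrices outside the big
    cell. *)
Lemma hw_orbit (q : Q) a b :
    delta_constant q -> quot_bihomog a b q -> q != 0 ->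
  exists2 e : nat -> Q, e 0%N = q & (b <= a)%N /\ forall g, g \in unitmx ->
    gl g q = \det g ^+ b *:
      \sum_(j < (a - b).+1) (g 0 0 ^+ (a - b - j) * g 1 0 ^+ j) *: e j.
Proof.
move=> /delta_constantP fixq qab q0; pose w' : 'M[K]_2 := mx2 0 1 (-1) 0.
have wU := weyl_unit K.
have w'U : w' \in unitmx by rewrite mx2_unit mulrN1 mul0r sub0r opprK oner_neq0.
have [N1 [v [v0 w'qE]]] := quot_gl_upper (gl w' q).
have [N2 [r [r0 wqE]]] := quot_gl_upper (gl (weyl K) q).
pose e j := (-1) ^+ j *: gl (weyl K) (v j).
pose N := maxn (maxn N1 N2) a.+1.
have [leN1 leN2 lt_aN] : [/\ N1 <= N, N2 <= N & a < N]%N.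
  by split; rewrite /N !leq_max leqnn ?orbT.
have e0 : e 0%N = q.
  rewrite /e expr0 scale1r v0 -quot_glM // -[RHS](fixq 0) mx2M.
  by congr (gl (mx2 _ _ _ _) q); ring.
(* Lower unipotent matrices are conjugate to upper ones under w. *)
have lowerE t : gl (lower t) q = \sum_(j < N) t ^+ j *: e j.
  have -> : lower t = weyl K *m (upper (- t) *m w').
    by rewrite !mx2M; congr mx2; ring.
  rewrite !quot_glM ?unitmx_mul ?upper_unit // (w'qE N) // quot_gl_sum //.
  by apply: eq_bigr => j _; rewrite quot_glZ // /e scalerA -exprMn mulrN1.
clearbody e.
have bigcell s b' c d : s != 0 -> s * d - b' * c != 0 ->
    gl (mx2 s b' c d) q = (s ^+ a * ((s * d - b' * c) / s) ^+ b) *: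
      \sum_(j < N) (c / s) ^+ j *: e j.
  move=> s0 det0; set r' := _ / s.
  have r'0 : r' != 0 by rewrite mulf_neq0 ?invr_neq0.
  have -> : mx2 s b' c d = lower (c / s) *m (torus s r' *m upper (b' / s)).
    by rewrite !mx2M /r'; congr mx2; field.
  have TU : torus s r' \in unitmx by rewrite torus_unit s0.
  rewrite !quot_glM ?unitmx_mul ?lower_unit ?upper_unit ?TU // fixq.
  by rewrite (quot_gl_torus s0 r'0 qab) quot_glZ ?lower_unit // lowerE.
(* Both expressions of u_s (w q), multiplied by s^(b + N) to have only
   nonnegative exponents, are compared exponent by exponent. *)
have coefs l : \sum_(k < N | (b + N + k == l)%N) r k
    + \sum_(j < N | (a + N - j == l)%N) - e j = 0.
  pose ex (i : 'I_N + 'I_N) := match i with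
    inl k => (b + N + k)%N | inr j => (a + N - j)%N end.
  pose ve (i : 'I_N + 'I_N) := match i with inl k => r k | inr j => - e j end.
  suff H m : \sum_i (2 ^+ m) ^+ ex i *: ve i = 0.
    have := isolate_exponent charK0 (subspace0 _) H l.
    by rewrite big_sumType.
  rewrite big_sumType /=; set s := 2 ^+ m.
  have s0 : s != 0 by rewrite expf_neq0 // natr_neq0.
  have cell : gl (upper s) (gl (weyl K) q) =
      (s ^+ a * (1 / s) ^+ b) *: \sum_(j < N) (1 / s) ^+ j *: e j.
    rewrite -quot_glM ?upper_unit //.
    have det1 : s * 0 - (-1) * 1 = 1 :> K by ring.
    have := @bigcell s (-1) 1 0 s0; rewrite det1 => <-; last exact: oner_neq0.
    by rewrite !mx2M; congr (gl (mx2 _ _ _ _) q); ring.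
  rewrite (wqE N) // in cell.
  under eq_bigr => k _ do rewrite exprD -scalerA.
  rewrite -scaler_sumr cell scalerA scaler_sumr -big_split big1 // => j _ /=.
  rewrite scalerA scalerN; apply/eqP; rewrite subr_eq0; apply/eqP.
  congr (_ *: _); rewrite -addnBA ?(ltnW (ltn_ord j)) //.
  have -> : s ^+ (b + N) = s ^+ b * s ^+ j * s ^+ (N - j).
    by rewrite -!exprD -addnA subnKC // ltnW.
  rewrite div1r !exprVn exprD; field.
  by rewrite (expf_neq0 j s0) (expf_neq0 b s0).
have e_eq0 j : (j < N)%N -> (a < b + j)%N -> e j = 0.
  move=> lt_jN lt_abj; have /eqP := coefs (a + N - j)%N.
  rewrite big1 => [|k /eqP]; last by lia.
  rewrite (big_pred1 (Ordinal lt_jN)) => [|k].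
    by rewrite add0r oppr_eq0 => /eqP.
  apply/eqP/eqP => [|->] //= kj; apply/val_inj => /=; have := ltn_ord k; lia.
have le_ba : (b <= a)%N.
  rewrite leqNgt; apply: contra q0 => lt_ab.
  by rewrite -e0 e_eq0 ?addn0 //; apply: leq_trans lt_aN.
pose n := (a - b)%N; have lt_nN : (n < N)%N by rewrite /n; lia.
have wq : gl (weyl K) q = e n.
  have N_gt0 : (0 < N)%N by lia.
  have /eqP := coefs (b + N)%N.
  rewrite (big_pred1 (Ordinal N_gt0)) => [|k]; last first.
    apply/eqP/eqP => [|->] /=; rewrite ?addn0 // => k0.
    by apply/val_inj => /=; lia.
  rewrite (big_pred1 (Ordinal lt_nN)) => [|k]; last first.
    apply/eqP/eqP => [|->] /=; last by rewrite /n; lia.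
    by move=> k0; apply/val_inj; rewrite /= /n; have := ltn_ord k; lia.
  by rewrite subr_eq0 /= r0 => /eqP.
exists e; rewrite // -/n; split=> // g gU.
have := gU; rewrite [g]mx2_eta.
move: (g 0 0) (g 0 1) (g 1 0) (g 1 1) => s b' c d.
rewrite mx2_unit det_mx2 !mxE /= => det0.
have [s0|s0] := eqVneq s 0; last first.
  rewrite bigcell // scaler_sumr scaler_sumr.
  rewrite [RHS](big_ord_widen N (fun j => (s * d - b' * c) ^+ b *:
    ((s ^+ (n - j) * c ^+ j) *: e j))) //.
  rewrite [RHS]big_mkcond; apply: eq_bigr => j _; rewrite !scalerA.
  case: ifP => lt_jn; last first.
    by rewrite e_eq0 ?scaler0 //; rewrite /n in lt_jn; lia.
  congr (_ *: _); rewrite /n.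
  have -> : s ^+ a = s ^+ (a - b - j) * s ^+ b * s ^+ j.
    by rewrite -!exprD; congr (_ ^+ _); rewrite /n in lt_jn; lia.
  rewrite !exprMn !exprVn; field.
  by rewrite !expf_neq0.
subst s; rewrite mul0r sub0r oppr_eq0 mulf_eq0 negb_or in det0.
have /andP[b0 c0] := det0.
have -> : mx2 0 b' c d = weyl K *m (torus c (- b') *m upper (d / c)).
  by rewrite !mx2M; congr mx2; field.
have TU : torus c (- b') \in unitmx by rewrite torus_unit c0 oppr_eq0.
rewrite !quot_glM ?unitmx_mul ?upper_unit ?TU // fixq.
rewrite (quot_gl_torus c0 _ qab) ?oppr_eq0 // quot_glZ // wq.
rewrite big_ord_recr big1 /= => [|j _]; last first.
  by rewrite expr0n subn_eq0 leqNgt ltn_ord mul0r scale0r.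
rewrite add0r subnn mul1r scalerA; congr (_ *: _).
have -> : c ^+ a = c ^+ n * c ^+ b by rewrite -exprD subnK.
rewrite mul0r sub0r -mulNr exprMn; ring.
Qed.
End Quotient.

(** * Binary forms *)

Section BinaryForms.
Variables (K : fieldType) (charK0 : [pchar K] =i pred0).
Local Notation form := {mpoly K[2]}.
Local Notation X := ('X_(0 : 'I_2) : form).
Local Notation Y := ('X_(1 : 'I_2) : form).

Definition mon_exp (n j : nat) : 'X_{1..2} :=
  (U_(0%R) *+ (n - j) + U_(1%R) *+ j)%MM.

Lemma mon_expE n j : 'X_[mon_exp n j] = X ^+ (n - j) * Y ^+ j.
Proof. by rewrite mpolyXD -!mpolyXn. Qed.

Lemma mon_exp1 n j : mon_exp n j 1 = j.
Proof. by rewrite mnmDE !mulmnE !mnm1E mul0n mul1n. Qed.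

Lemma mdeg_mon_exp n j : (j <= n)%N -> mdeg (mon_exp n j) = n.
Proof. by move=> le_jn; rewrite mdegD !mdegMn !mdeg1 !mul1n subnK. Qed.

Lemma mon_homog n j : (j <= n)%N -> X ^+ (n - j) * Y ^+ j \is n.-homog.
Proof. by move=> le_jn; rewrite -mon_expE dhomogX /= mdeg_mon_exp. Qed.

Lemma mcoeff_mon n j k :
  (X ^+ (n - j) * Y ^+ j)@_(mon_exp n k) = (j == k)%:R.
Proof.
rewrite -mon_expE mcoeffX; congr (nat_of_bool _)%:R.
apply/eqP/eqP => [|->//].
by move=> /(congr1 (fun m : 'X_{1..2} => m 1)); rewrite !mon_exp1.
Qed.

Lemma mdeg_eq_mon_exp (m : 'X_{1..2}) : m = mon_exp (mdeg m) (m 1).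
Proof.
apply/mnmP => i; rewrite mdegE !big_ord_recl big_ord0 addn0.
rewrite mnmDE !mulmnE !mnm1E (_ : lift ord0 ord0 = 1); last exact: val_inj.
by case: (ord2P i) => ->; rewrite ?addnK ?mul0n ?mul1n ?addn0.
Qed.

Lemma form_sum n (p : form) : p \is n.-homog ->
  p = \sum_(j < n.+1) p@_(mon_exp n j) *: (X ^+ (n - j) * Y ^+ j).
Proof.
move=> hp; apply/mpolyP => m; rewrite raddf_sum /=.
have [mn|mn] := eqVneq (mdeg m) n; last first.
  rewrite (dhomog_nemf_coeff hp mn) big1 // => j _; rewrite mcoeffZ.
  have /dhomog_nemf_coeff -> // : X ^+ (n - j) * Y ^+ j \is n.-homog.
    by apply: mon_homog; rewrite -ltnS.
  by rewrite mulr0.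
rewrite [m]mdeg_eq_mon_exp mn.
have lt_mn : (m 1%R < n.+1)%N.
  by rewrite ltnS -mn mdegE (bigD1 (1 : 'I_2)) //= leq_addr.
rewrite (bigD1 (Ordinal lt_mn)) //= mcoeffZ mcoeff_mon eqxx mulr1.
rewrite big1 ?addr0 // => j jm; rewrite mcoeffZ mcoeff_mon.
by case: eqP => [E|]; [case/eqP: jm; apply: val_inj | rewrite mulr0].
Qed.

Lemma form_sum0 n (p : form) : p \is n.-homog ->
  (forall j, (0 < j <= n)%N -> p@_(mon_exp n j) = 0) ->
  p = p@_(mon_exp n 0) *: X ^+ n.
Proof.
move=> hp p0; rewrite {1}(form_sum hp) big_ord_recl expr0 mulr1 subn0.
by rewrite big1 ?addr0 // => j _; rewrite p0 ?scale0r // lift0 ltn_ord.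
Qed.

Lemma lin_pow n (s t : K) : (s *: X + t *: Y) ^+ n =
  \sum_(j < n.+1)
    (s ^+ (n - j) * t ^+ j * 'C(n, j)%:R) *: (X ^+ (n - j) * Y ^+ j).
Proof.
rewrite exprDn; apply: eq_bigr => j _.
by rewrite !exprZn -scalerAl -scalerAr scalerA -scaler_nat scalerA mulrC.
Qed.

Lemma W_act_linear l (g : 'M[K]_2) : linear (W_act l g).
Proof. by move=> c p q; rewrite /W_act linearP /= scalerDr !scalerA mulrC. Qed.
HB.instance Definition _ l g :=
  GRing.isLinear.Build K form form *:%R (W_act l g) (W_act_linear l g).

Lemma W_act_mon l (a b c d : K) i j :
  W_act l (mx2 a b c d) (X ^+ i * Y ^+ j) =
  (a * d - b * c) ^+ l *: ((a *: X + c *: Y) ^+ i * (b *: X + d *: Y) ^+ j).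
Proof.
rewrite /W_act det_mx2 rmorphM !rmorphXn /= !comp_mpolyXU -!tnth_nth.
rewrite !tnth_mktuple !big_ord_recl !big_ord0 !mxE /= !addr0.
rewrite (_ : lift ord0 ord0 = 1 :> 'I_2); last exact: val_inj.
by [].
Qed.

(** W_act substitutes linear forms, hence sends powers of linear forms to powers
    of linear forms. *)
Lemma W_act_lin_pow l (a b c d s t : K) n :
  W_act l (mx2 a b c d) ((s *: X + t *: Y) ^+ n) =
  (a * d - b * c) ^+ l *: ((a * s + b * t) *: X + (c * s + d * t) *: Y) ^+ n.
Proof.
rewrite /W_act det_mx2 rmorphXn /= rmorphD /= !comp_mpolyZ !comp_mpolyXU.
rewrite -!tnth_nth !tnth_mktuple !big_ord_recl !big_ord0 !mxE /= !addr0.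
rewrite (_ : lift ord0 ord0 = 1 :> 'I_2); last exact: val_inj.
congr (_ *: _ ^+ _); rewrite !scalerDr !scalerA addrACA -!scalerDl.
by rewrite !(mulrC s) !(mulrC t).
Qed.

Lemma W_act_homog l (g : 'M[K]_2) n p :
  p \is n.-homog -> W_act l g p \is n.-homog.
Proof.
move=> /form_sum ->; rewrite linear_sum rpred_sum // => j _.
rewrite linearZ /= [g]mx2_eta W_act_mon !rpredZ //.
have lin s t k : (s *: X + t *: Y) ^+ k \is k.-homog.
  rewrite -{2}[k]mul1n; apply: dhomogMn.
  by rewrite rpredD ?rpredZ ?dhomogX /= ?mdeg1.
have := dhomogM (lin (g 0 0) (g 1 0) (n - j)%N) (lin (g 0 1) (g 1 1) j).
by rewrite subnK // -ltnS.
Qed.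

(** If j is the largest index for which X^(n - j) Y^j occurs in p, then u_t p is
    a polynomial in t whose coefficient of degree j is a nonzero multiple
    of X^n: a monomial X^(n - k) Y^k contributes to it only when k >= j. *)
Lemma raising_contains_X l n (N : form -> Prop) p :
    subspace N -> (forall t p, N p -> N (W_act l (upper t) p)) ->
    p \is n.-homog -> p != 0 -> N p ->
  N (X ^+ n).
Proof.
move=> subN stabN hp p0 Np; pose c (j : nat) := p@_(mon_exp n j).
have [j0 cj0] : exists j0 : 'I_n.+1, c j0 != 0.
  apply/existsP; apply: contraR p0; rewrite negb_exists => /forallP c0.
  rewrite (form_sum hp) big1 // => j _.
  suff -> : p@_(mon_exp n j) = 0 by rewrite scale0r.
  by apply/eqP/negbNE/c0.
have [j cj max_j] := @arg_maxnP 'I_n.+1 j0 (fun j => c j != 0) val cj0.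
(* The coefficient of t^i in u_t p. *)
pose V (i : nat) := \sum_(k < n.+1)
  (c k * 'C(k, i)%:R) *: (X ^+ (n - k) * Y ^+ (k - i) * X ^+ i).
have NV : N (V j).
  apply: (isolate_coef charK0 subN (n := n.+1)) => // t.
  have := stabN t p Np; congr N.
  rewrite {1}(form_sum hp) linear_sum /=.
  under [RHS]eq_bigr => i _ do rewrite /V scaler_sumr.
  rewrite exchange_big /=; apply: eq_bigr => k _.
  rewrite linearZ /= W_act_mon mulr1 mulr0 subr0 expr1n !scale1r scale0r addr0.
  rewrite [t *: X + _]addrC exprDn.
  rewrite (big_ord_widen n.+1
    (fun i => (Y ^+ (k - i) * (t *: X) ^+ i) *+ 'C(k, i))) //.
  rewrite big_mkcond mulr_sumr scaler_sumr; apply: eq_bigr => i _.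
  rewrite ltnS scalerA; case: leqP => [le_ik|lt_ki].
    rewrite exprZn -scaler_nat -!scalerAr !scalerA mulrA.
    by congr (_ *: _); ring.
  by rewrite bin_small // !mulr0 scale0r scaler0.
have VE : V j = c j *: X ^+ n.
  transitivity ((c j * 'C(j, j)%:R) *: (X ^+ (n - j) * Y ^+ (j - j) * X ^+ j)).
    rewrite /V (bigD1 j) // big1 => [|k kj]; first exact: addr0.
    have [ck|ck] := eqVneq (c k) 0.
      by rewrite ck mul0r scale0r.
    rewrite bin_small ?mulr0 ?scale0r // ltn_neqAle; apply/andP; split=> //.
    exact: max_j.
  rewrite binn subnn expr0 !mulr1 -exprD.
  by rewrite subnK // -ltnS.
by rewrite -[X ^+ n](scalerK cj) -VE; apply: subspaceZ.
Qed.

Section SymMap.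
Variables (V : lmodType K) (n : nat) (e : nat -> V).

(** Dividing by the binomials makes the image of (s X + t Y)^n the sum of the
    s^(n - j) t^j e_j, which is the shape of the orbit of a highest weight
    vector. *)
Definition sym_map (p : form) : V :=
  \sum_(j < n.+1) (p@_(mon_exp n j) / 'C(n, j)%:R) *: e j.

Lemma sym_map_linear : linear sym_map.
Proof.
move=> c p q; rewrite /sym_map scaler_sumr -big_split; apply: eq_bigr => j _.
by rewrite mcoeffD mcoeffZ mulrDl scalerDl scalerA mulrA.
Qed.
HB.instance Definition _ :=
  GRing.isLinear.Build K form V *:%R sym_map sym_map_linear.

Lemma sym_map_lin_pow s t : sym_map ((s *: X + t *: Y) ^+ n) =
  \sum_(j < n.+1) (s ^+ (n - j) * t ^+ j) *: e j.
Proof.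
rewrite /sym_map; apply: eq_bigr => j _; congr (_ *: _).
rewrite lin_pow raddf_sum (bigD1 j) //= mcoeffZ mcoeff_mon eqxx mulr1.
rewrite big1 => [|k kj]; last first.
  rewrite mcoeffZ mcoeff_mon; case: eqP => [E|]; last by rewrite mulr0.
  by case/eqP: kj; apply: val_inj.
by rewrite addr0 mulfK // natr_neq0 // bin_gt0 -ltnS.
Qed.

(** The powers (X + t Y)^n span the forms of degree n: their coefficients in t
    are the monomials times binomials, which are nonzero in characteristic 0. *)
Lemma eq_on_lin_pow (F : form -> V) p : linear F ->
    (forall t, F ((1 *: X + t *: Y) ^+ n) = 0) -> p \is n.-homog -> F p = 0.
Proof.
move=> Flin; pose L : {linear form -> V} :=
  HB.pack F (GRing.isLinear.Build K form V *:%R F Flin).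
rewrite -[F]/(L : form -> V); move: L => {Flin} {}F Fpow hp.
rewrite (form_sum hp) linear_sum big1 // => j _.
rewrite linearZ /= (_ : F _ = 0) ?scaler0 //.
have bin0 : 'C(n, j)%:R != 0 :> K by rewrite natr_neq0 // bin_gt0 -ltnS.
apply: (scalerI bin0); rewrite scaler0.
apply: (isolate_coef charK0 (subspace0 V) (n := n.+1)
  (v := fun j => 'C(n, j)%:R *: F (X ^+ (n - j) * Y ^+ j))) => // t.
rewrite -[RHS](Fpow t) lin_pow linear_sum.
by apply: eq_bigr => k _; rewrite expr1n mul1r [RHS]linearZ /= scalerA.
Qed.
End SymMap.
End BinaryForms.

(** * Highest weight vectors and constants *)

Section HighestWeight.
Variables (K : fieldType) (charK0 : [pchar K] =i pred0).
Variables (I : ideal K) (I_inv : gl_invariant I).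
Local Notation Q := (quot_alg I).
Local Notation gl := (@quot_gl K I).
Local Notation form := {mpoly K[2]}.
Local Notation X := ('X_(0 : 'I_2) : form).
Local Notation Y := ('X_(1 : 'I_2) : form).

Lemma subspace_gl_submodule (N : Q -> Prop) : gl_submodule N -> subspace N.
Proof. by case=> N0 Nlin _; split. Qed.

(** By the orbit formula the linear map phi from the forms of degree n = a - b
    with phi (X^n) = q commutes with GL_2.  Every nonzero submodule of its image
    contains q = phi (X^n), hence also the whole image, since the coefficients
    e_j of the lower unipotent orbit of q span it.  Injectivity is the case of
    the zero submodule. *)
Lemma constant_highest_weight (q : Q) a b :
    delta_constant q -> quot_bihomog a b q -> q != 0 ->
  highest_weight_vector q.
Proof.
move=> constq qab q0.
have [e e0 [le_ba orbit]] := hw_orbit charK0 I_inv constq qab q0.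
set n := (a - b)%N in orbit; pose phi := sym_map n e.
have X_pow : X ^+ n = (1 *: X + 0 *: Y) ^+ n by rewrite scale1r scale0r addr0.
have hX : X ^+ n \is n.-homog.
  by rewrite -[X ^+ n]mulr1 -(expr0 Y) -{1}[n]subn0 mon_homog.
have phiX : phi (X ^+ n) = q.
  rewrite X_pow /phi sym_map_lin_pow // big_ord_recl big1 => [|j _].
    by rewrite expr1n mul1r scale1r e0 addr0.
  by rewrite lift0 exprS mul0r mulr0 scale0r.
have phi_pow t : phi ((1 *: X + t *: Y) ^+ n) = gl (lower t) q.
  rewrite /phi sym_map_lin_pow // orbit ?lower_unit // det_mx2 !mxE /=.
  by rewrite mulr1 mul0r subr0 expr1n scale1r.
have phi_equiv g p : g \in unitmx -> p \is n.-homog ->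
    phi (W_act b g p) = gl g (phi p).
  move=> gU hp; apply/eqP; rewrite -subr_eq0; apply/eqP.
  pose F p' := phi (W_act b g p') - gl g (phi p').
  apply: (eq_on_lin_pow charK0 (F := F) _ _ hp) => [c u v|t]; rewrite /F.
    by rewrite /phi !linearP /= quot_gl_linear // opprD addrACA scalerBr.
  rewrite phi_pow -quot_glM ?lower_unit // orbit ?unitmx_mul ?gU ?lower_unit //.
  rewrite /phi {1}[g]mx2_eta W_act_lin_pow [sym_map n e _]linearZ /=.
  rewrite sym_map_lin_pow //.
  rewrite [g in g *m _]mx2_eta.
  rewrite mx2M det_mx2 !mxE /= !mulr1 !mulr0 !add0r.
  apply/eqP; rewrite subr_eq0; apply/eqP; congr (_ ^+ _ *: _); ring.
(* The preimage of N under phi is stable under the u_t. *)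
have phi_top (N : Q -> Prop) (p : form) :
    gl_submodule N -> p \is n.-homog -> p != 0 -> N (phi p) -> N q.
  move=> subN hp p0 Np; rewrite -phiX.
  pose N' (p : form) := p \is n.-homog /\ N (phi p).
  suff [] : N' (X ^+ n) by [].
  apply: (raising_contains_X charK0 (l := b) (p := p)) => //.
    split=> [|c u v [hu Nu] [hv Nv]].
      split; first exact: dhomog0.
      by rewrite /phi linear0; case: subN.
    split; first by rewrite rpredD ?rpredZ.
    by rewrite /phi linearP; case: subN => _ Nlin _; apply: Nlin.
  move=> t u [hu Nu]; split; first exact: W_act_homog.
  rewrite phi_equiv ?upper_unit //; case: subN => _ _; apply => //.
  exact: upper_unit.
pose M u := exists2 p, p \is n.-homog & u = phi p.
have subM : gl_submodule M.
  split=> [|c _ _ [p hp ->] [p' hp' ->]|g _ gU [p hp ->]].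
  - by exists 0; rewrite ?dhomog0 // /phi linear0.
  - by exists (c *: p + p'); rewrite ?rpredD ?rpredZ // /phi linearP.
  - by exists (W_act b g p); rewrite ?W_act_homog // phi_equiv.
have sub0 : gl_submodule (fun u : Q => u = 0).
  split=> // [c u v -> ->|g u gU ->]; first by rewrite scaler0 addr0.
  exact: quot_gl0.
exists M, a, b; split=> //.
- split=> //; first by exists q => //; exists (X ^+ n).
  move=> N subN NM.
  have [[u [Nu u0]]|noN] := boolp.pselect (exists u, N u /\ u <> 0).
    right; have [p hp up] := NM u Nu; have Nq : N q.
      apply: (phi_top N p) => //; last by rewrite -up.
      by apply/eqP => p0; case: u0; rewrite up p0 /phi linear0.
    have Ne j : (j < n.+1)%N -> N (e j).
      apply: (isolate_coef charK0 (subspace_gl_submodule subN)) => t.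
      have : N (gl (lower t) q).
        by case: subN => _ _; apply; rewrite ?lower_unit.
      rewrite -phi_pow /phi sym_map_lin_pow //; congr N.
      by apply: eq_bigr => j' _; rewrite expr1n mul1r.
    move=> _ [p' hp' ->]; apply: (subspace_sum (subspace_gl_submodule subN)).
    move=> j _ _; apply: subspaceZ (Ne j _) => //.
    exact: subspace_gl_submodule.
  by left=> u Nu; apply: boolp.contrapT => u0; apply: noN; exists u.
- exists phi; split=> // p p' hp hp' Epp'; apply/eqP; rewrite -subr_eq0.
  apply: contraT => p0; case/negP: q0; apply/eqP.
  apply: (phi_top (fun u => u = 0) (p - p')) => //; first by rewrite rpredB.
  by apply/eqP; rewrite /phi linearB subr_eq0; apply/eqP.
- by split=> //; exists (X ^+ n).
Qed.

(** Let q = phi p.  The bidegree of q makes diag(1, 2) act on p as 2^l2, while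
    it multiplies X^(n - j) Y^j by 2^(l2 + j); so p is a multiple of X^n, which
    the u_t fix. *)
Lemma highest_weight_constant (q : Q) :
  highest_weight_vector q -> delta_constant q.
Proof.
case=> M [l1 [l2 [le_l _ [phi [phi_inj MP phi_equiv]] [Mq q0 qll]]]].
set n := (l1 - l2)%N in phi_inj MP phi_equiv; have [p hp qp] := (MP q).1 Mq.
have two0 : 2 != 0 :> K by rewrite natr_neq0.
have TU : torus 1 2 \in @unitmx K 2 by rewrite torus_unit oner_neq0.
have eigen : W_act l2 (torus 1 2) p = 2 ^+ l2 *: p.
  apply: phi_inj; rewrite ?W_act_homog ?rpredZ // phi_equiv // -qp.
  rewrite (quot_gl_torus I_inv _ two0 qll) ?oner_neq0 // expr1n mul1r.
  by rewrite linearZ /= -qp.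
have pE : p = p@_(mon_exp n 0) *: X ^+ n.
  apply: form_sum0 => // j /andP[j0 le_jn].
  have := congr1 (mcoeff (mon_exp n j)) eigen.
  rewrite {1}(form_sum hp) linear_sum raddf_sum /= mcoeffZ.
  have lt_jn : (j < n.+1)%N by [].
  have termE (k : 'I_n.+1) : (W_act l2 (torus 1 2)
      (p@_(mon_exp n k) *: (X ^+ (n - k) * Y ^+ k)))@_(mon_exp n j) =
      p@_(mon_exp n k) * 2 ^+ l2 * 2 ^+ k * (k == j :> nat)%:R.
    rewrite [W_act _ _ _]linearZ /= W_act_mon mulr0 subr0 mul1r scale1r.
    rewrite !scale0r addr0 add0r.
    by rewrite exprZn -scalerAr !mcoeffZ mcoeff_mon !mulrA.
  under eq_bigr => k _ do rewrite termE.
  rewrite (bigD1 (Ordinal lt_jn)) //= eqxx mulr1 big1 => [|k kj]; last first.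
    case: eqP => [E|]; last by rewrite mulr0.
    by case/eqP: kj; apply: val_inj.
  rewrite addr0 [p@__ * _]mulrC => /eqP.
  rewrite -subr_eq0 -{2}[_ * p@__]mulr1 -mulrBr.
  rewrite !mulf_eq0 (negPf (expf_neq0 _ two0)) subr_eq0 /=.
  case/orP=> [/eqP //|/eqP E]; have := @exp2_inj K charK0 j 0%N.
  by rewrite /= E => /(_ erefl) j00; rewrite j00 in j0.
apply/(delta_constantP charK0 I_inv) => t.
rewrite qp -phi_equiv ?upper_unit //; congr (phi _); rewrite pE linearZ /=.
rewrite -[X ^+ n]mulr1 -(expr0 Y) W_act_mon mulr1 mulr0 subr0 expr1n !scale1r.
by rewrite scale0r addr0.
Qed.
End HighestWeight.

Theorem theorem4p6 (K : fieldType) (charK0 : [pchar K]%R =i pred0)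
    (I : ideal K) (I_inv : gl_invariant I) (q : quot_alg I) :
  delta_constant q <-> in_span (@highest_weight_vector K I) q.
Proof.
split=> [constq | [s [hw_s ->]]].
  have [r [-> rP]] := delta_constant_bihomog charK0 I_inv constq.
  exists [seq (1, u) | u <- r & u != 0]; split=> [_ /mapP[u + ->] /=|].
    rewrite mem_filter => /andP[u0 /rP[constu [a [b uab]]]].
    exact: constant_highest_weight uab u0.
  rewrite big_map big_filter [RHS]big_mkcond; apply: eq_bigr => u _ /=.
  by rewrite scale1r; case: eqP.
have subC := subspace_delta_constant charK0 I_inv.
apply: (subspace_sum subC) => t st _; apply: subspaceZ => //.
exact: highest_weight_constant (hw_s t st).
Qed.
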